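(* Let $a,b\in\mathbb{N}$, $b\geq 2$, where $(a,b)=1$ and $b\neq 3$. Then $S(1,a,b)=0$ if and only if $2b=3a+k+1$ for some integer $k$ with $0\leq k\leq b-2$.
   Context: $\mathbb{N}$ denotes the positive integers and $(a,b)$ the greatest common divisor of $a$ and $b$. For $n,a,b\in\mathbb{N}$ with $b\geq 2$, define $$S(n,a,b):=\sum_{m=1}^{b-1}\cot\left(\frac{\pi m}{b}\right)\sin^{3}\left(2\pi mn\frac{a}{b}\right).$$
   Formalization: The hypothesis a < b is added: without it the claim fails, e.g. for a = 3, b = 2, where S(1,3,2) = 0 but 2b = 3a + k + 1 forces k = -6 < 0; S depends only on a mod b, while the right-hand condition forces a < b. *)

(* Defs.v *)
From mathcomp Require Import all_boot all_order all_algebra.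
From mathcomp Require Import reals trigo.

Set Implicit Arguments.
Unset Strict Implicit.
Unset Printing Implicit Defensive.

Import Order.TTheory GRing.Theory Num.Theory.

Local Open Scope ring_scope.

Definition cot (R : realType) (x : R) : R := cos x / sin x.

(* At every argument pi m / b with 0 < m < b the sine in the denominator of
   cot is nonzero, so division by zero never occurs in this sum. *)
Definition cot_sin3_sum (R : realType) (n a b : nat) : R :=
  \sum_(1 <= m < b)
     cot (pi * m%:R / b%:R) * sin (2 * pi * m%:R * n%:R * (a%:R / b%:R)) ^+ 3.

(* Main.v *)
Require Import Defs.
From mathcomp Require Import all_boot all_order all_algebra.
From mathcomp Require Import reals trigo.
From mathcomp Require Import ring zify.

Import Order.TTheory GRing.Theory Num.Theory.

Local Open Scope ring_scope.

(* The finite Fourier expansion of the sawtooth function says that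
   T(j) = sum_(0 < m < b) cot (pi m / b) sin (2 pi m j / b) equals b - 2 j for
   0 < j < b.  It follows from T(j + 1) - T(j) = C(j) + C(j + 1), where C(j) is
   the sum of cos (2 pi m j / b) over 0 < m < b, that is b - 1 or -1 according
   to whether b divides j.  Since 4 sin^3 x = 3 sin x - sin 3x, four times the
   sum under study is 3 T(a) - T(3a) = 2 b (1 - floor (3a / b)), because b does
   not divide 3a; so it vanishes exactly when b < 3a < 2b. *)

(** Replacing [m] by [m %% b] shifts the argument by a multiple of [pi], which only affects the
    sign, and lands in the open interval from 0 to [pi]. *)
Lemma sin_pi_frac_neq0 (R : realType) (m b : nat) :
  (0 < b)%N -> ~~ (b %| m)%N -> sin (pi * m%:R / b%:R : R) != 0.
Proof.
move=> b_gt0 ndvd; have b0 : (b%:R : R) != 0 by rewrite pnatr_eq0 -lt0n.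
rewrite {1}(divn_eq m b) natrD natrM.
have -> : pi * ((m %/ b)%:R * b%:R + (m %% b)%:R) / b%:R
    = pi * (m %% b)%:R / b%:R + pi *+ (m %/ b) :> R.
  by field.
rewrite (alternatingn (@sinDpi R)) mulf_neq0 ?signr_eq0 // gt_eqF //.
have pi0 := pi_gt0 R.
rewrite sin_gt0_pi // -mulrA pmulr_rgt0 // divr_gt0 ?ltr0n ?(lt0n (_ %% _)) //=.
by rewrite gtr_pMr // ltr_pdivrMr ?ltr0n // mul1r ltr_nat ltn_mod.
Qed.

Lemma sum_cos_pi_frac (R : realType) (j b : nat) : (0 < b)%N ->
  \sum_(1 <= m < b) cos (2 * pi * m%:R * j%:R / b%:R) =
  b%:R * (b %| j)%:R - 1 :> R.
Proof.
move=> b_gt0; have b0 : (b%:R : R) != 0 by rewrite pnatr_eq0 -lt0n.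
suff : \sum_(0 <= m < b) cos (2 * pi * m%:R * j%:R / b%:R) =
    b%:R * (b %| j)%:R :> R.
  by rewrite big_ltn // mulr0 !mul0r cos0 => <-; rewrite addrC addKr.
have [/dvdnP[q ->]|ndvd] := boolP (b %| j)%N.
  under eq_bigr => m _.
    rewrite (_ : _ / _ = 0 + (pi *+ 2) *+ (m * q)); last first.
      by field.
    rewrite (periodicn (@cosD2pi R)) cos0; over.
  by rewrite sumr_const_nat subn0 mulr1.
have sx0 := sin_pi_frac_neq0 R j b b_gt0 ndvd; set x := _ / _ in sx0.
apply: (mulIf sx0); rewrite mulr0 mul0r mulr_suml.
apply: (mulIf (_ : 2 != 0 :> R)); first by rewrite pnatr_eq0.
rewrite mul0r mulr_suml.
(* Telescoping by 2 sin x cos 2mx = sin (2m+1)x - sin (2m-1)x; the end values agree because 2bx is a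
   multiple of 2 pi. *)
rewrite (@telescope_sumr_eq _ _ _ (fun m => sin (2 * m%:R * x - x))) //.
  have -> : 2 * b%:R * x = 0 + (pi *+ 2) *+ j.
    by rewrite /x; field.
  rewrite addrAC (periodicn (@sinD2pi R)) mulr0 mul0r subrr //.
move=> m _.
have -> : 2 * pi * m%:R * j%:R / b%:R = 2 * m%:R * x by rewrite /x; field.
have -> : 2 * m.+1%:R * x - x = 2 * m%:R * x + x by rewrite -natr1; ring.
by rewrite sinB sinD; ring.
Qed.

Definition cot_sin_sum (R : realType) (j b : nat) : R :=
  \sum_(1 <= m < b) cot (pi * m%:R / b%:R) * sin (2 * pi * m%:R * j%:R / b%:R).

Lemma cot_sin_sumS (R : realType) (j b : nat) : (0 < b)%N ->
  cot_sin_sum R j.+1 b =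
  cot_sin_sum R j b + b%:R * ((b %| j)%:R + (b %| j.+1)%:R) - 2.
Proof.
move=> b_gt0; have b0 : (b%:R : R) != 0 by rewrite pnatr_eq0 -lt0n.
suff : cot_sin_sum R j.+1 b - cot_sin_sum R j b =
    \sum_(1 <= m < b) cos (2 * pi * m%:R * j%:R / b%:R)
    + \sum_(1 <= m < b) cos (2 * pi * m%:R * j.+1%:R / b%:R).
  by rewrite !sum_cos_pi_frac // => /eqP; rewrite subr_eq => /eqP ->; ring.
rewrite -sumrB -big_split; apply: eq_big_nat => m /andP[m_gt0 ltmb] /=.
rewrite -mulrBr /cot.
have s0 : sin (pi * m%:R / b%:R : R) != 0.
  by apply: sin_pi_frac_neq0 => //; rewrite gtnNdvd.
(* With [y] midway between the two arguments, sin (y+t) - sin (y-t) = 2 cos y sin t; [cot] turns sin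
   t into cos t, and 2 cos y cos t = cos (y-t) + cos (y+t). *)
set t := pi * m%:R / b%:R in s0 *; set y := t + 2 * pi * m%:R * j%:R / b%:R.
have -> : 2 * pi * m%:R * j.+1%:R / b%:R = y + t.
  by rewrite /y /t -natr1; field.
have -> : 2 * pi * m%:R * j%:R / b%:R = y - t by rewrite /y; ring.
by rewrite cosB (cosD y) sinB sinD; field.
Qed.

(* The indicator of [b %| j] makes the formula correct at the jumps of the
   sawtooth, where the sum is 0. *)
Lemma cot_sin_sumE (R : realType) (j b : nat) : (0 < b)%N ->
  cot_sin_sum R j b = b%:R * (2 * (j %/ b)%:R + 1 - (b %| j)%:R) - 2 * j%:R.
Proof.
move=> b_gt0; elim: j => [|j IHj].
  rewrite /cot_sin_sum big1 => [|m _]; last by rewrite mulr0 mul0r sin0 mulr0.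
  by rewrite div0n dvdn0 mulr1n; ring.
by rewrite cot_sin_sumS // IHj divnS // natrD -natr1; ring.
Qed.

Lemma sin_mulr3 (R : realType) (x : R) : sin (3 * x) = 3 * sin x - 4 * sin x ^+ 3.
Proof.
have -> : 3 * x = x *+ 2 + x by ring.
rewrite sinD sin_mulr2n cos_mulr2n.
have -> : 3 * sin x - 4 * sin x ^+ 3 =
    4 * sin x * (1 - sin x ^+ 2) - sin x :> R by ring.
by rewrite -cos2sin2; ring.
Qed.

Lemma cot_sin3_sumE (R : realType) (n a b : nat) :
  4 * cot_sin3_sum R n a b =
  3 * cot_sin_sum R (n * a) b - cot_sin_sum R (3 * (n * a)) b.
Proof.
rewrite /cot_sin3_sum /cot_sin_sum !mulr_sumr -sumrB; apply: eq_bigr => m _.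
set x := 2 * pi * m%:R * n%:R * (a%:R / b%:R).
have -> : 2 * pi * m%:R * (n * a)%:R / b%:R = x by rewrite /x natrM; ring.
have -> : 2 * pi * m%:R * (3 * (n * a))%:R / b%:R = 3 * x.
  by rewrite /x !natrM; ring.
by rewrite sin_mulr3; ring.
Qed.

(* The bound a < b is implicit in the source: the sum depends only on a mod b,
   while the right-hand side forces 3a < 2b, so without it a = 3, b = 2 is a
   counterexample. *)
Theorem proposition1p3 (R : realType) (a b : nat)
    (ha : (0 < a)%N) (hb : (2 <= b)%N) (hab : (a < b)%N)
    (hcop : coprime a b) (hb3 : b <> 3%N) :
  cot_sin3_sum R 1 a b = 0 <->
  exists k : int,
    (0 <= k <= b%:Z - 2) /\ 2 * b%:Z = 3 * a%:Z + k + 1.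
Proof.
have b_gt0 : (0 < b)%N by exact: ltnW.
have ndvd3a : ~~ (b %| 3 * a)%N.
  rewrite Gauss_dvdl 1?coprime_sym //; apply/negP => /prime_nt_dvdP b3.
  by apply/hb3/b3; rewrite // gtn_eqF.
have sumE : 4 * cot_sin3_sum R 1 a b = 2 * b%:R * (1 - (3 * a %/ b)%:R).
  rewrite cot_sin3_sumE mul1n !cot_sin_sumE // (negPf ndvd3a) gtnNdvd //.
  by rewrite divn_small // natrM /=; ring.
have -> : cot_sin3_sum R 1 a b = 0 <-> (3 * a %/ b)%N = 1%N.
  split=> [S0|q1]; last first.
    by apply/eqP; move/eqP: sumE; rewrite q1 subrr mulr0 mulf_eq0 pnatr_eq0.
  move/esym/eqP: sumE; rewrite S0 mulr0 !mulf_eq0 !pnatr_eq0 subr_eq0 (eqr_nat _ 1).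
  by rewrite (gtn_eqF b_gt0) => /eqP <-.
have := divn_eq (3 * a) b; have := ltn_pmod (3 * a) b_gt0.
move: ndvd3a; rewrite /dvdn; set q := (_ %/ _)%N; set r := (_ %% _)%N.
move=> r0 rb e; split=> [q1|[k [kb ek]]]; last by nia.
(* Quotient 1 means 3a = b + r, so 2b = 3a + (b - r), forcing k = b - r - 1; the bound k <= b - 2 is
   exactly r > 0. *)
by exists (b%:Z - r%:Z - 1); rewrite q1 in e; split; lia.
Qed.
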